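(* Let $\Theta=\operatorname{conv}\{\theta_1,\dots,\theta_{\mathsf p}\}$, let $y,y^+\in\mathbb R^{\mathsf f}$, and let $X(y)$ be nonempty with $X(y)\subseteq\mathbb X$. Suppose that for every $x\in X(y)$ there exists $u\in\mathbb U$ such that $$\widetilde f_F(x,u,\theta_k)+d\le y^+\qquad\text{for all }k\in\{1,\dots,\mathsf p\}.$$ Then $X(y^+)\in\mathcal F(X(y))$.
   Context: System. $\mathbb X\subset\mathbb R^{n_x}$, $\mathbb U\subset\mathbb R^{n_u}$, $\mathbb W\subset\mathbb R^{n_x}$, $\Theta\subset\mathbb R^{n_\theta}$ are nonempty, compact, convex sets containing the origin, and $\Theta$ is a polytope. Put $\mathcal Z=\mathbb X\times\mathbb U\times\Theta$. The map $f:\mathcal Z\to\mathbb R^{n_x}$ admits a difference-of-convex (DC) decomposition $f_i=g_i-h_i$, $i=1,\dots,n_x$, with $g_i,h_i:\mathcal Z\to\mathbb R$ finite-valued convex. Vector inequalities are componentwise. Directional bounds. Fix $\bar z\in\operatorname{ri}(\mathcal Z)$ (relative interior) and subgradients $s_{g_i}\in\partial g_i(\bar z)$, $s_{h_i}\in\partial h_i(\bar z)$; set $g_i^L(z)=g_i(\bar z)+s_{g_i}^\top(z-\bar z)$ and $h_i^L(z)=h_i(\bar z)+s_{h_i}^\top(z-\bar z)$. For $c\in\mathbb R^{n_x}$ and $z\in\mathcal Z$ let $$\widetilde f(z;\bar z,c)=\sum_{i:\,c_i\ge0}c_i\bigl(g_i(z)-h_i^L(z)\bigr)+\sum_{i:\,c_i<0}c_i\bigl(g_i^L(z)-h_i(z)\bigr).$$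 Template. $F\in\mathbb R^{\mathsf f\times n_x}$ is a fixed matrix with rows $F_1,\dots,F_{\mathsf f}$ such that $Fx\le0$ implies $x=0$. For $y\in\mathbb R^{\mathsf f}$, $X(y)=\{x\in\mathbb R^{n_x}\mid Fx\le y\}$. Define $\widetilde f_F(x,u,\theta)\in\mathbb R^{\mathsf f}$ for $(x,u,\theta)\in\mathcal Z$ as the vector with $l$-th entry $\widetilde f((x,u,\theta);\bar z,F_l^\top)$, and $d\in\mathbb R^{\mathsf f}$ by $d_l=\max_{w\in\mathbb W}F_lw$. Robust successors. For compact $X\subseteq\mathbb X$, $\mathcal F(X)$ is the collection of all $X^+\subseteq\mathbb R^{n_x}$ such that for every $x\in X$ there exists $u\in\mathbb U$ with $f(x,u,\theta)+w\in X^+$ for all $\theta\in\Theta$ and all $w\in\mathbb W$. *)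

(* Defs.v *)
From HB Require Import structures.
From mathcomp Require Import all_boot all_order all_algebra.
From mathcomp Require Import all_classical all_reals all_analysis.

Set Implicit Arguments.
Unset Strict Implicit.
Unset Printing Implicit Defensive.

Import Order.TTheory GRing.Theory Num.Theory.
Import numFieldNormedType.Exports.

Local Open Scope classical_set_scope.
Local Open Scope ring_scope.

(* MathComp-Analysis.  R^n is 'cV[R]_n. *)

Definition lev (R : realType) (n : nat) (u v : 'cV[R]_n) : Prop :=
  forall i, u i 0 <= v i 0.

Notation "u <=v v" := (lev u v) (at level 70, no associativity) : ring_scope.

Definition dotv (R : realType) (n : nat) (u v : 'cV[R]_n) : R :=
  (u^T *m v) 0 0.

Definition conv_hull (R : realType) (n : nat) (A : set 'cV[R]_n) :
    set 'cV[R]_n :=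
  smallest (@convex_set R 'cV[R]_n) A.

Definition polytope (R : realType) (n : nat) (A : set 'cV[R]_n) : Prop :=
  exists2 S : set 'cV[R]_n, finite_set S & A = conv_hull S.

Definition affine_set (R : realType) (n : nat) (A : set 'cV[R]_n) : Prop :=
  forall x y (t : R), A x -> A y -> A (t *: x + (1 - t) *: y).

Definition aff_hull (R : realType) (n : nat) (A : set 'cV[R]_n) :
    set 'cV[R]_n :=
  smallest (@affine_set R n) A.

(* Interior of A for the topology induced on its affine hull. *)
Definition rel_interior (R : realType) (n : nat) (A : set 'cV[R]_n) :
    set 'cV[R]_n :=
  [set z | aff_hull A z /\ within (aff_hull A) (nbhs z) A].

Definition admissible_set (R : realType) (n : nat) (A : set 'cV[R]_n) : Prop :=
  [/\ A !=set0, compact A, convex_set A & A 0].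

(* R^nx x R^nu x R^nt is identified with R^(nx + nu + nt). *)
Definition stack (R : realType) (nx nu nt : nat)
    (x : 'cV[R]_nx) (u : 'cV[R]_nu) (th : 'cV[R]_nt) : 'cV[R]_(nx + nu + nt) :=
  col_mx (col_mx x u) th.

Definition stack_set (R : realType) (nx nu nt : nat)
    (X : set 'cV[R]_nx) (U : set 'cV[R]_nu) (Th : set 'cV[R]_nt) :
    set 'cV[R]_(nx + nu + nt) :=
  [set z | exists x u th, [/\ X x, U u, Th th & z = stack x u th]].

(* A function on D is a function on the whole space of which only the values
   on D matter; the subgradient inequality is required on D only, as for the
   extension of g by +oo outside D. *)
Definition subdifferential (R : realType) (n : nat) (D : set 'cV[R]_n)
    (g : 'cV[R]_n -> R) (zb : 'cV[R]_n) : set 'cV[R]_n :=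
  [set s | forall z, D z -> g zb + dotv s (z - zb) <= g z].

Definition DC_decomposition (R : realType) (n m : nat) (D : set 'cV[R]_n)
    (f : 'cV[R]_n -> 'cV[R]_m) (g h : 'I_m -> 'cV[R]_n -> R) : Prop :=
  [/\ forall i, convex_function D (g i),
      forall i, convex_function D (h i) &
      forall z, D z -> forall i, f z i 0 = g i z - h i z].

Definition linearization (R : realType) (n : nat) (g : 'cV[R]_n -> R)
    (zb s z : 'cV[R]_n) : R :=
  g zb + dotv s (z - zb).

Definition ftilde (R : realType) (n m : nat) (g h : 'I_m -> 'cV[R]_n -> R)
    (zb : 'cV[R]_n) (sg sh : 'I_m -> 'cV[R]_n) (c : 'cV[R]_m)
    (z : 'cV[R]_n) : R :=
  \sum_(i < m | 0 <= c i 0)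
      c i 0 * (g i z - linearization (h i) zb (sh i) z) +
  \sum_(i < m | c i 0 < 0)
      c i 0 * (linearization (g i) zb (sg i) z - h i z).

Definition ftilde_F (R : realType) (n m k : nat) (F : 'M[R]_(k, m))
    (g h : 'I_m -> 'cV[R]_n -> R) (zb : 'cV[R]_n) (sg sh : 'I_m -> 'cV[R]_n)
    (z : 'cV[R]_n) : 'cV[R]_k :=
  \col_(l < k) ftilde g h zb sg sh (row l F)^T z.

Definition template_set (R : realType) (m k : nat) (F : 'M[R]_(k, m))
    (y : 'cV[R]_k) : set 'cV[R]_m :=
  [set x | F *m x <=v y].

(* For W compact and nonempty the supremum is a maximum: disturbance_boundP. *)
Definition disturbance_bound (R : realType) (m k : nat) (F : 'M[R]_(k, m))
    (W : set 'cV[R]_m) : 'cV[R]_k :=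
  \col_(l < k) sup [set (row l F *m w) 0 0 | w in W].

Lemma disturbance_boundP (R : realType) (m k : nat) (F : 'M[R]_(k, m))
    (W : set 'cV[R]_m) (l : 'I_k) : W !=set0 -> compact W ->
  (exists2 w, W w & (row l F *m w) 0 0 = disturbance_bound F W l 0) /\
  (forall w, W w -> (row l F *m w) 0 0 <= disturbance_bound F W l 0).
Proof.
move=> W0 cW; pose phi (w : 'cV[R]_m) := (row l F *m w) 0 0.
have phiC : continuous phi.
  have -> : phi = (fun w => \sum_(j < m) row l F 0 j * w j 0).
    by apply/funext => w; rewrite /phi mxE.
  have coordC j : continuous (fun w : 'cV[R]_m => row l F 0 j * w j 0).
    move=> w.
    apply: (@continuousM R _ (cst (row l F 0 j)) (fun w : 'cV[R]_m => w j 0)).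
      exact: cst_continuous.
    exact: coord_continuous.
  exact: (@continuous_big R _ +%R 0 xpredT (@add_continuous _)
    'cV[R]_m (index_enum 'I_m) _ (fun j _ => coordC j)).
have [w0 w0W maxw0] := compact_EVT_max W0 cW (continuous_subspaceT phiC).
have supE : disturbance_bound F W l 0 = phi w0.
  rewrite mxE; apply/le_anti/andP; split.
    apply: ge_sup; first by case: W0 => w Ww; exists (phi w), w.
    by move=> _ [w Ww <-]; apply: maxw0; rewrite inE.
  apply: ub_le_sup; last by exists w0 => //; rewrite inE in w0W.
  by exists (phi w0) => _ [w Ww <-]; apply: maxw0; rewrite inE.
rewrite supE; split; first by exists w0 => //; rewrite inE in w0W.
by move=> w Ww; apply: maxw0; rewrite inE.
Qed.

(* The collection is only meaningful for compact X included in XX; it is empty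
   for any other X. *)
Definition robust_successors (R : realType) (nx nu nt : nat)
    (XX : set 'cV[R]_nx) (U : set 'cV[R]_nu) (Th : set 'cV[R]_nt)
    (W : set 'cV[R]_nx) (f : 'cV[R]_(nx + nu + nt) -> 'cV[R]_nx)
    (X : set 'cV[R]_nx) : set (set 'cV[R]_nx) :=
  [set Xp | [/\ compact X, X `<=` XX &
     forall x, X x -> exists2 u, U u &
       forall th w, Th th -> W w -> Xp (f (stack x u th) + w)]].

(* Main.v *)
(* F_l f <= ftilde(.; F_l) on Z by the subgradient inequalities, and each
   ftilde(.; F_l) is convex, so its bound y+_l - d_l propagates from the
   vertices theta_j to all of Theta. *)
Require Import Defs.
From mathcomp Require Import all_boot all_order all_algebra.
From mathcomp Require Import all_classical all_reals all_analysis.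
From mathcomp Require Import ring.

Set Implicit Arguments.
Unset Strict Implicit.

Import Order.TTheory GRing.Theory Num.Theory.
Import numFieldNormedType.Exports.

Local Open Scope classical_set_scope.
Local Open Scope ring_scope.

(** Linearizing at [zb] the part of each [g i - h i] that has the wrong curvature, as dictated by
    the sign of the weight [c i 0], gives a function [ftilde] that lies above the scalar product of
    [c] and [f] ([dotv_le_ftilde]) and is convex on the stacked domain ([ftilde_convex]). Fix [x]
    and the input [u] chosen for it. By convexity, a bound on [ftilde] at the vertices of [Th] holds
    on their whole hull ([conv_hull_sublevel]). With [c] a row of [F] and [yp - d] as the bound,
    each row of [F] applied to [f] is at most [yp - d]; the margin [d] absorbs any disturbance in
    [W], so the successor lies in the template set of [yp]. *)

Section ConvexFunctions.
Context {R : realType} {E : lmodType R}.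
Implicit Types (D : set (convex_lmodType E)) (f g : convex_lmodType E -> R).

Lemma convex_functionP D f :
  convex_function D f <->
  forall (t : {i01 R}) (x y : E), D x -> D y ->
    f (t%:num *: x + (1 - t%:num) *: y) <=
    t%:num * f x + (1 - t%:num) * f y.
Proof.
split=> [fC t x y Dx Dy|fC t x y]; first by apply: fC; rewrite inE.
by rewrite !inE; apply: fC.
Qed.

Lemma convex_functionD D f g :
  convex_function D f -> convex_function D g ->
  convex_function D (fun x => f x + g x).
Proof.
move=> /convex_functionP fC /convex_functionP gC; apply/convex_functionP.
move=> t x y Dx Dy; apply: le_trans (lerD (fC t x y Dx Dy) (gC t x y Dx Dy)) _.
by rewrite !mulrDr addrACA.
Qed.

Lemma convex_functionZ D f (a : R) : 0 <= a ->
  convex_function D f -> convex_function D (fun x => a * f x).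
Proof.
move=> a_ge0 /convex_functionP fC; apply/convex_functionP => t x y Dx Dy.
apply: le_trans (ler_wpM2l a_ge0 (fC t x y Dx Dy)) _.
by rewrite mulrDr !(mulrCA a).
Qed.

Lemma convex_function_sum D (I : Type) (r : seq I) (P : pred I)
    (F : I -> convex_lmodType E -> R) :
  (forall i, P i -> convex_function D (F i)) ->
  convex_function D (fun x => \sum_(i <- r | P i) F i x).
Proof.
move=> FC; apply/convex_functionP => t x y Dx Dy.
rewrite !mulr_sumr -big_split; apply: ler_sum => i Pi.
by have /convex_functionP := FC i Pi; apply.
Qed.

End ConvexFunctions.

Section Linearization.
Context {R : realType} {n : nat}.

Lemma linearization_affine (g : 'cV[R]_n -> R) (zb s x y : 'cV[R]_n) (t : R) :
  linearization g zb s (t *: x + (1 - t) *: y) =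
  t * linearization g zb s x + (1 - t) * linearization g zb s y.
Proof.
rewrite /linearization.
have -> : t *: x + (1 - t) *: y - zb = t *: (x - zb) + (1 - t) *: (y - zb).
  by apply/matrixP => i j; rewrite !mxE; ring.
by rewrite /dotv mulmxDr -!scalemxAr !mxE; ring.
Qed.

(** An affine function satisfies the convexity inequality with equality, so its negative is convex
    too. *)
Lemma convex_functionBlin (D : set 'cV[R]_n) (f g : 'cV[R]_n -> R)
    (zb s : 'cV[R]_n) :
  convex_function D f ->
  convex_function D (fun z => f z - linearization g zb s z).
Proof.
move=> fC; apply: convex_functionD => //; apply/convex_functionP => t x y _ _.
by rewrite linearization_affine opprD !mulrN.
Qed.

End Linearization.

Section DirectionalBound.
Context {R : realType} {n m : nat} (D : set 'cV[R]_n).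
Context (f : 'cV[R]_n -> 'cV[R]_m) (g h : 'I_m -> 'cV[R]_n -> R).
Context (zb : 'cV[R]_n) (sg sh : 'I_m -> 'cV[R]_n).
Hypothesis fDC : DC_decomposition D f g h.

Lemma ftilde_convex (c : 'cV[R]_m) :
  convex_function D (ftilde g h zb sg sh c).
Proof.
have [gC hC _] := fDC.
apply: convex_functionD; apply: convex_function_sum => i ci.
  by apply: convex_functionZ => //; apply: convex_functionBlin.
(* For a negative weight, flipping both signs exhibits the term as a positive multiple of convex
   minus affine. *)
rewrite [X in convex_function _ X](_ : _ = fun z =>
    - c i 0 * (h i z - linearization (g i) zb (sg i) z)); last first.
  by apply/funext => z; ring.
apply: convex_functionZ; first by rewrite oppr_ge0 ltW.
exact: convex_functionBlin.
Qed.

Hypothesis sgP : forall i, subdifferential D (g i) zb (sg i).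
Hypothesis shP : forall i, subdifferential D (h i) zb (sh i).

(** Each linearization minorizes its convex function on [D]. Replacing [h i] by its linearization
    thus raises [g i - h i], and replacing [g i] lowers it; a negative weight turns the latter into
    an upper bound. *)
Lemma dotv_le_ftilde (c : 'cV[R]_m) (z : 'cV[R]_n) : D z ->
  dotv c (f z) <= ftilde g h zb sg sh c z.
Proof.
have [_ _ fE] := fDC => Dz; rewrite /dotv mxE (bigID (fun i => 0 <= c i 0)) /=.
rewrite /ftilde [X in _ <= _ + X](eq_bigl (fun i => ~~ (0 <= c i 0))); last first.
  by move=> i; rewrite ltNge.
apply: lerD; apply: ler_sum => i ci; rewrite mxE fE//.
  by apply: ler_wpM2l => //; rewrite lerD2l lerN2; apply: shP.
by apply: ler_wnM2l; [rewrite ltW // ltNge | rewrite lerD2r; apply: sgP].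
Qed.

End DirectionalBound.

(** An intersection of closed half-spaces; inside the compact [X] this yields the compactness that
    [robust_successors] demands. *)
Lemma closed_template_set (R : realType) (m k : nat) (F : 'M[R]_(k, m))
    (y : 'cV[R]_k) : closed (template_set F y).
Proof.
have -> : template_set F y =
    \bigcap_(l in [set: 'I_k]) [set x | (F *m x) l 0 <= y l 0].
  by apply/seteqP; split => [x Fx l _|x Fx l]; apply: Fx.
apply: closed_bigI => l _.
apply: (@closed_comp _ _ (fun x => (F *m x) l 0) [set r | r <= y l 0]); last first.
  exact: closed_le.
move=> x _; rewrite (_ : (fun x => _) =
    (fun x : 'cV[R]_m => \sum_j F l j * x j 0)); last first.
  by apply/funext => {}x; rewrite mxE.
apply: (@continuous_big R _ +%R 0 xpredT (@add_continuous _)) => j _ {}x.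
apply: continuousM; [exact: cst_continuous | exact: coord_continuous].
Qed.

Lemma conv_hull_sublevel (R : realType) (nx nu nt : nat)
    (X : set 'cV[R]_nx) (U : set 'cV[R]_nu) (Th A : set 'cV[R]_nt)
    (phi : 'cV[R]_(nx + nu + nt) -> R) x u a :
  convex_function (stack_set X U Th) phi -> Th = conv_hull A -> X x -> U u ->
  (forall th, A th -> phi (stack x u th) <= a) ->
  forall th, Th th -> phi (stack x u th) <= a.
Proof.
move=> /convex_functionP phiC ThE Xx Uu phiA.
have ThC : convex_set Th.
  rewrite ThE => v w t; rewrite !inE => Hv Hw B [BC AB].
  by have := BC v w t; rewrite !inE; apply; [apply: Hv | apply: Hw].
(* By minimality of the hull, it suffices that this sublevel set is convex and contains [A].
   Membership in [Th] is kept in it because [phi] is convex only on the stacked domain. *)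
suff : Th `<=` [set th | Th th /\ phi (stack x u th) <= a].
  by move=> sub th /sub [].
rewrite {1}ThE; apply: smallest_sub; last first.
  move=> th Ath; split; last exact: phiA.
  by rewrite ThE; apply: sub_gen_smallest.
move=> v w t; rewrite !inE => -[Thv phiv] [Thw phiw]; split.
  by have := ThC v w t; rewrite !inE; apply.
(* The blocks [x] and [u] are the same at both endpoints, and the weights sum to 1. *)
have -> : stack x u (conv t v w) =
    t%:num *: stack x u v + (1 - t%:num) *: stack x u w.
  by rewrite /stack !scale_col_mx !add_col_mx -!scalerDl addrC subrK !scale1r.
have Dx th : Th th -> stack_set X U Th (stack x u th) by exists x, u, th.
apply: le_trans (phiC t _ _ (Dx _ Thv) (Dx _ Thw)) _.
apply: (@le_trans _ _ (t%:num * a + (1 - t%:num) * a)); last first.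
  by rewrite -mulrDl addrC subrK mul1r.
by apply: lerD; apply: ler_wpM2l => //; rewrite subr_ge0.
Qed.

Theorem proposition7 (R : realType) (nx nu nt k p : nat)
    (X : set 'cV[R]_nx) (U : set 'cV[R]_nu) (W : set 'cV[R]_nx)
    (Th : set 'cV[R]_nt)
    (f : 'cV[R]_(nx + nu + nt) -> 'cV[R]_nx)
    (g h : 'I_nx -> 'cV[R]_(nx + nu + nt) -> R)
    (zb : 'cV[R]_(nx + nu + nt))
    (sg sh : 'I_nx -> 'cV[R]_(nx + nu + nt))
    (F : 'M[R]_(k, nx))
    (theta : 'I_p -> 'cV[R]_nt)
    (y yp : 'cV[R]_k) :
  admissible_set X -> admissible_set U -> admissible_set W ->
  admissible_set Th -> polytope Th ->
  DC_decomposition (stack_set X U Th) f g h ->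
  rel_interior (stack_set X U Th) zb ->
  (forall i, subdifferential (stack_set X U Th) (g i) zb (sg i)) ->
  (forall i, subdifferential (stack_set X U Th) (h i) zb (sh i)) ->
  (forall x : 'cV[R]_nx, F *m x <=v 0 -> x = 0) ->
  Th = conv_hull (range theta) ->
  template_set F y !=set0 ->
  template_set F y `<=` X ->
  (forall x, template_set F y x -> exists2 u, U u &
     forall j : 'I_p,
       ftilde_F F g h zb sg sh (stack x u (theta j)) + disturbance_bound F W
         <=v yp) ->
  robust_successors X U Th W f (template_set F y) (template_set F yp).

Proof.
move=> [_ cX _ _] _ [W0 cW _ _] _ _ fDC _ sgP shP _ ThE _ yX yP.
split=> //; first exact: subclosed_compact (@closed_template_set _ _ _ F y) cX yX.
move=> x yx; have [u Uu uP] := yP x yx; exists u => // th w Thth Ww l.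
have [_ /(_ w Ww) wd] := disturbance_boundP F l W0 cW.
rewrite mulmxDr mxE -lerBrDr.
have Dz : stack_set X U Th (stack x u th) by exists x, u, th; split=> //; apply: yX.
have := dotv_le_ftilde fDC sgP shP (row l F)^T Dz.
rewrite /dotv trmxK -!row_mul !mxE in wd * => /le_trans; apply.
(* Passing to the worst disturbance gives a bound independent of [w] and [th], as needed for the
   hull argument. *)
apply: (@le_trans _ _ (yp l 0 - disturbance_bound F W l 0)); last first.
  by rewrite lerD2l lerN2 mxE.
apply: (conv_hull_sublevel (ftilde_convex zb sg sh fDC _) ThE) => //.
  exact: yX.
by move=> _ [j _ <-]; have := uP j l; rewrite lerBrDr !mxE.
Qed.
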